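(* Let $I$ be an isotopy in $\mathrm{Homeo}_0(\mathbb{A})$ from the identity to a homeomorphism $f$, and suppose $\rho_{\mathrm{ann}}(I)$ contains both a positive and a negative real number. Then there exists a compact (not necessarily invariant) set $K\subset\mathbb{A}$ such that $0\in\rho_K(I)$.
   Context: $\mathbb{T}^1=\mathbb{R}/\mathbb{Z}$, $\mathbb{A}=\mathbb{T}^1\times\mathbb{R}$ is the open annulus with universal covering $\pi:\mathbb{R}^2\to\mathbb{A}$ and $p_1:\mathbb{R}^2\to\mathbb{R}$ the first coordinate projection. $\mathrm{Homeo}_0(\mathbb{A})$ is the set of homeomorphisms of $\mathbb{A}$ isotopic to the identity. For an isotopy $I=(f_t)_{t\in[0,1]}$ from the identity to $f=f_1$, let $(\tilde f_t)$ be its lift to $\mathbb{R}^2$ with $\tilde f_0=\mathrm{Id}$, and $\tilde f=\tilde f_1$. For $z\in\mathbb{A}$ and $n\ge1$, $\rho_n(z)=\frac1n(p_1(\tilde f^n(\tilde z))-p_1(\tilde z))$ with $\tilde z\in\pi^{-1}(z)$. For a compact $K\subset\mathbb{A}$, $\rho_K(I)=\bigcap_{m\ge1}\mathrm{Cl}\big(\bigcup_{n\ge m}\{\rho_n(z): z\in K,\ f^n(z)\in K\}\big)$, closure in $\overline{\mathbb{R}}=\mathbb{R}\cup\{\pm\infty\}$, and $\rho_{\mathrm{ann}}(I)=\mathrm{Cl}\big(\bigcup_K\rho_K(I)\big)$, union over all compact $K\subset\mathbb{A}$. *)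

(* Defs.v *)
From Stdlib Require Import Reals.
Open Scope R_scope.

(* The universal cover R^2 of the annulus A = T^1 x R, with covering map
   pi(x,y) = (x mod 1, y) and deck transformation T(x,y) = (x+1,y). *)
Definition pt : Type := (R * R)%type.
Definition p1 (z : pt) : R := fst z.
Definition deckT (z : pt) : pt := (fst z + 1, snd z).

Definition dist2 (z w : pt) : R := Rmax (Rabs (fst z - fst w)) (Rabs (snd z - snd w)).

Definition cont2 (h : pt -> pt) : Prop :=
  forall z eps, 0 < eps -> exists delta, 0 < delta /\
    forall w, dist2 w z < delta -> dist2 (h w) (h z) < eps.

Definition homeo2 (h : pt -> pt) : Prop :=
  cont2 h /\ exists g : pt -> pt, cont2 g /\
    (forall z, g (h z) = z) /\ (forall z, h (g z) = z).

(* Lift (tilde f_t)_{t in [0,1]} to R^2 of an isotopy I = (f_t) in Homeo_0(A)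
   from the identity, normalized by tilde f_0 = Id.  Isotopies on A correspond
   exactly to such deck-equivariant isotopies on R^2. *)
Definition lifted_isotopy (H : R -> pt -> pt) : Prop :=
  (forall t z eps, 0 <= t <= 1 -> 0 < eps -> exists delta, 0 < delta /\
     forall s w, 0 <= s <= 1 -> Rabs (s - t) < delta -> dist2 w z < delta ->
       dist2 (H s w) (H t z) < eps) /\
  (forall z, H 0 z = z) /\
  (forall t, 0 <= t <= 1 -> homeo2 (H t)) /\
  (forall t z, 0 <= t <= 1 -> H t (deckT z) = deckT (H t z)).

(* A subset K of A is represented by its full preimage Kt = pi^{-1}(K) in R^2
   (a deck-invariant set).  K is compact in A = T^1 x R iff Kt is closed in
   R^2 and bounded in the second coordinate. *)
Definition compact_annulus (Kt : pt -> Prop) : Prop :=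
  (forall z, Kt z <-> Kt (deckT z)) /\
  (forall z, ~ Kt z -> exists delta, 0 < delta /\ forall w, dist2 w z < delta -> ~ Kt w) /\
  (exists M, forall z, Kt z -> Rabs (snd z) <= M).

Definition rho_n (F : pt -> pt) (n : nat) (z : pt) : R :=
  (p1 (Nat.iter n F z) - p1 z) / INR n.

(* A real number r belongs to rho_K(I) (intersection over m of the closures
   in the extended line of the sets {rho_n(z) : n >= m, z in K, f^n(z) in K};
   on real points closure in Rbar agrees with closure in R). *)
Definition in_rho_K (F : pt -> pt) (Kt : pt -> Prop) (r : R) : Prop :=
  forall (m : nat) eps, 0 < eps -> exists (n : nat) (z : pt),
    (1 <= n)%nat /\ (m <= n)%nat /\ Kt z /\ Kt (Nat.iter n F z) /\
    Rabs (rho_n F n z - r) < eps.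

(* A real number r belongs to rho_ann(I), the closure in Rbar of the union of
   the rho_K(I) over compact K (small neighbourhoods of a real r in Rbar
   contain only real numbers). *)
Definition in_rho_ann (F : pt -> pt) (r : R) : Prop :=
  forall eps, 0 < eps -> exists (Kt : pt -> Prop) (s : R),
    compact_annulus Kt /\ in_rho_K F Kt s /\ Rabs (s - r) < eps.

(* Main.v *)
Require Import Defs.
From Stdlib Require Import Reals Lra Lia Bool ZArith Classical.
From Coquelicot Require Import Coquelicot.
Open Scope R_scope.

(** Suppose that 0 lies in no rho_K, and let K range over the closed annuli
    |y| <= M.  A segment of K and its deck translate have disjoint images under
    f^n; since an arc over a horizontal line meets its unit translate as soon as
    its endpoints are at least 1 apart, the displacements of the points of K
    returning to K at time n have no gap of length 2.  For n large they avoid a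
    neighbourhood of 0 of size proportional to n, so they all have the same sign,
    and if K met f^n(K) for all large n this sign could not change from n to n+1.
    As both signs occur for arbitrarily large n, every large K is disjoint from
    some f^n(K), and the isotopy being end-preserving, f^n pushes the half annulus
    beyond K.  Applying this to K and to a larger annulus shows that K never
    returns to itself after some time, which contradicts the hypothesis. *)

(** * Topology of the line and of the plane *)

Lemma continuous_IVT (f : R -> R) (a b c : R) :
  (forall x, continuous f x) -> a <= b -> f a <= c <= f b \/ f b <= c <= f a ->
  exists s, a <= s <= b /\ f s = c.
Proof.
  intros Hf Hab Hc.
  destruct (IVT_gen_consistent f a b c Hf) as [s [Hs Es]].
  - unfold Rmin, Rmax. destruct (Rle_dec (f a) (f b)); lra.
  - exists s. rewrite Rmin_left, Rmax_right in Hs by exact Hab. split; assumption.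
Qed.

Lemma ball_Rabs (x d y : R) : ball x d y <-> Rabs (y - x) < d.
Proof. reflexivity. Qed.

Lemma closed_max (E : R -> Prop) (b : R) :
  closed E -> (exists s, E s) -> (forall s, E s -> s <= b) ->
  exists m, E m /\ forall s, E s -> s <= m.
Proof.
  intros HE Hne Hb. destruct (completeness E) as [m [Hub Hlub]].
  - exists b; exact Hb.
  - exact Hne.
  - exists m; split; [|exact Hub].
    apply HE; intros [d Hd].
    assert (Hle : m <= m - d).
    { apply Hlub. intros s Hs. apply Rnot_lt_le; intros Hlt.
      apply (Hd s); [|exact Hs]. specialize (Hub s Hs).
      apply ball_Rabs, Rabs_def1; lra. }
    pose proof (cond_pos d). lra.
Qed.

Lemma closed_min (E : R -> Prop) (a : R) :
  closed E -> (exists s, E s) -> (forall s, E s -> a <= s) ->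
  exists m, E m /\ forall s, E s -> m <= s.
Proof.
  intros HE [s0 Hs0] Ha.
  destruct (closed_max (fun s => E (- s)) (- a)) as [m [Hm Hmax]].
  - apply (closed_comp Ropp E); [|exact HE].
    intros x. apply (filterlim_opp x).
  - exists (- s0). rewrite Ropp_involutive. exact Hs0.
  - intros s Hs. specialize (Ha _ Hs). lra.
  - exists (- m); split; [exact Hm|]. intros s Hs.
    assert (- s <= m); [apply Hmax; rewrite Ropp_involutive; exact Hs|lra].
Qed.

Lemma closed_adjacent (E E' : R -> Prop) (a b : R) :
  closed E -> closed E' -> a <= b -> E a -> E' b ->
  exists s t, a <= s <= t /\ t <= b /\ E s /\ E' t /\
    forall u, s < u < t -> ~ E u /\ ~ E' u.
Proof.
  intros HE HE' Hab Ea Eb.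
  destruct (closed_max (fun s => E s /\ s <= b) b) as [s [[Es Hsb] Hmax]].
  { apply closed_and; [exact HE|apply closed_le]. }
  { exists a; split; assumption. }
  { intros s Hs; apply Hs. }
  destruct (closed_min (fun t => E' t /\ s <= t) s) as [t [[Et Hst] Hmin]].
  { apply closed_and; [exact HE'|apply closed_ge]. }
  { exists b; split; assumption. }
  { intros t Ht; apply Ht. }
  assert (Has : a <= s) by (apply Hmax; split; assumption).
  assert (Htb : t <= b) by (apply Hmin; split; assumption).
  exists s, t. repeat split; try assumption; intros Eu.
  - assert (u <= s); [apply Hmax; split; [exact Eu|lra]|lra].
  - assert (t <= u); [apply Hmin; split; [exact Eu|lra]|lra].
Qed.

Lemma continuous_fst_comp {U V W : UniformSpace} (f : U -> V * W) (x : U) :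
  continuous f x -> continuous (fun y => fst (f y)) x.
Proof.
  intros Hf. apply (continuous_comp f fst); [exact Hf|].
  destruct (f x); apply continuous_fst.
Qed.

Lemma continuous_snd_comp {U V W : UniformSpace} (f : U -> V * W) (x : U) :
  continuous f x -> continuous (fun y => snd (f y)) x.
Proof.
  intros Hf. apply (continuous_comp f snd); [exact Hf|].
  destruct (f x); apply continuous_snd.
Qed.

Lemma continuous_pair {U V W : UniformSpace} (f : U -> V) (g : U -> W) (x : U) :
  continuous f x -> continuous g x -> continuous (fun y => (f y, g y)) x.
Proof.
  intros Hf Hg. apply (continuous_comp_2 f g pair); [exact Hf|exact Hg|].
  apply (continuous_ext (fun p => p)); [intros []; reflexivity|apply continuous_id].
Qed.

Lemma locally_filter_prod {U V : UniformSpace} (x : U) (y : V) (P : U * V -> Prop) :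
  locally (x, y) P -> filter_prod (locally x) (locally y) P.
Proof.
  intros [d Hd]. exists (ball x d) (ball y d); [apply locally_ball..|].
  intros x' y' Hx Hy. apply Hd. split; assumption.
Qed.

Lemma interval_induction (E : R -> Prop) (a b : R) :
  a <= b -> E a ->
  (forall m, a <= m <= b -> exists d, 0 < d /\ forall s s',
     a <= s <= m -> m - d < s -> s <= s' <= b -> s' < m + d -> E s -> E s') ->
  E b.
Proof.
  intros Hab Ea Hext.
  destruct (completeness (fun s => a <= s <= b /\ E s)) as [m [Hub Hlub]];
    [exists b; intros s [Hs _]; lra|exists a; split; [lra|exact Ea]|].
  assert (Hm : a <= m <= b).
  { split; [apply Hub; split; [lra|exact Ea]|apply Hlub; intros s [Hs _]; lra]. }
  destruct (Hext m Hm) as [d [Hd Hstep]].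
  assert (Hs : exists s, (a <= s <= b /\ E s) /\ m - d < s).
  { apply NNPP; intros Hno. assert (m <= m - d); [|lra].
    apply Hlub. intros s Es. apply Rnot_lt_le; intros Hlt.
    apply Hno. exists s; split; assumption. }
  destruct Hs as [s [[Hs Es] Hsm]].
  assert (Hle : s <= m) by (apply Hub; split; assumption).
  destruct (Rlt_le_dec b (m + d)) as [Hb|Hb]; [apply (Hstep s b); tauto || lra|].
  assert (Hmore : m + d / 2 <= m); [|lra].
  apply Hub. split; [lra|]. apply (Hstep s); try assumption; lra.
Qed.

Lemma filter_forall_interval {T : Type} (F : (T -> Prop) -> Prop) {FF : Filter F}
    (P : T -> R -> Prop) (a b : R) :
  (forall x, a <= x <= b ->
     filter_prod F (locally x) (fun p => P (fst p) (snd p))) ->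
  F (fun t => forall x, a <= x <= b -> P t x).
Proof.
  intros Hloc.
  destruct (Rle_dec a b) as [Hab|Hab]; [|apply filter_forall; intros; lra].
  apply (interval_induction
    (fun s => F (fun t => forall x, a <= x <= s -> P t x)) a b Hab).
  - destruct (Hloc a) as [Q S FQ [d HS] HP]; [lra|].
    revert FQ; apply filter_imp. intros t Qt x Hx. replace x with a by lra.
    apply (HP t a Qt), HS, ball_center.
  - intros m Hm. destruct (Hloc m Hm) as [Q S FQ [d HS] HP].
    exists d; split; [apply cond_pos|].
    intros s s' Hs Hsm Hs' Hs'm Fs. generalize (filter_and _ _ FQ Fs).
    apply filter_imp. intros t [Qt Pt] x Hx.
    destruct (Rle_dec x s); [apply Pt; lra|].
    apply (HP t x Qt), HS, ball_Rabs, Rabs_def1; lra.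
Qed.

Lemma filter_forall_rectangle {T : Type} (F : (T -> Prop) -> Prop) {FF : Filter F}
    (P : T -> R * R -> Prop) (a b a' b' : R) :
  (forall z, a <= fst z <= b -> a' <= snd z <= b' ->
     filter_prod F (locally z) (fun p => P (fst p) (snd p))) ->
  F (fun t => forall z, a <= fst z <= b -> a' <= snd z <= b' -> P t z).
Proof.
  intros Hloc.
  assert (Hcols : F (fun t => forall x, a <= x <= b ->
    forall y, a' <= y <= b' -> P t (x, y))).
  { apply (filter_forall_interval F
      (fun t x => forall y, a' <= y <= b' -> P t (x, y))).
    intros x Hx.
    apply (filter_forall_interval (filter_prod F (locally x))
      (fun p y => P (fst p) (snd p, y))).
    intros y Hy. destruct (Hloc (x, y) Hx Hy) as [Q S FQ [d HS] HP].
    exists (fun p => Q (fst p) /\ ball x d (snd p)) (ball y d).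
    - exists Q (ball x d); [exact FQ|apply locally_ball|split; assumption].
    - apply locally_ball.
    - intros p y' [Qp Hp] Hy'. apply HP; [exact Qp|].
      apply HS. split; assumption. }
  revert Hcols. apply filter_imp. intros t Ht [x y] Hx Hy. apply Ht; assumption.
Qed.

(** * The Poincare-Miranda theorem *)

Definition corner (i j i' j' : nat) : Prop :=
  (i' = i \/ i' = S i) /\ (j' = j \/ j' = S j).

Definition constant_on_cell (b : nat -> nat -> bool) (i j : nat) : Prop :=
  forall k l k' l', corner i j k l -> corner i j k' l' -> b k l = b k' l'.

Fixpoint xor_sum (b : nat -> bool) (n : nat) : bool :=
  match n with
  | O => false
  | S k => xorb (xor_sum b k) (b k)
  end.

Lemma xor_sum_telescope (b c : nat -> bool) (n : nat) :
  (forall i, (i < n)%nat -> b i = xorb (c i) (c (S i))) ->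
  xor_sum b n = xorb (c O) (c n).
Proof.
  induction n as [|n IH]; intros Hb; simpl.
  - rewrite xorb_nilpotent. reflexivity.
  - rewrite IH, Hb by auto with arith.
    destruct (c O), (c n), (c (S n)); reflexivity.
Qed.

Lemma xor_sum_xorb (b c : nat -> bool) (n : nat) :
  xor_sum (fun i => xorb (b i) (c i)) n = xorb (xor_sum b n) (xor_sum c n).
Proof.
  induction n as [|n IH]; simpl; [reflexivity|]. rewrite IH.
  destruct (xor_sum b n), (xor_sum c n), (b n), (c n); reflexivity.
Qed.

Definition door (r u : nat -> nat -> bool) (i j i' j' : nat) : bool :=
  negb (u i j) && negb (u i' j') && xorb (r i j) (r i' j').

Lemma cell_doors_even (r u : nat -> nat -> bool) (i j : nat) :
  constant_on_cell r i j \/ constant_on_cell u i j ->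
  xorb (door r u i j (S i) j) (door r u i (S j) (S i) (S j))
  = xorb (door r u i j i (S j)) (door r u (S i) j (S i) (S j)).
Proof.
  intros Hconst. unfold door.
  assert (Hcorners : forall b, constant_on_cell b i j ->
    b (S i) j = b i j /\ b i (S j) = b i j /\ b (S i) (S j) = b i j).
  { intros b Hb. unfold constant_on_cell, corner in Hb. auto 10. }
  destruct Hconst as [Hc|Hc]; apply Hcorners in Hc; destruct Hc as [-> [-> ->]].
  - rewrite !xorb_nilpotent, !andb_false_r. reflexivity.
  - destruct (u i j), (r i j), (r (S i) j), (r i (S j)), (r (S i) (S j)); reflexivity.
Qed.

(* A door is an edge on which [u] is false and [r] changes.  Were [r] or [u]
   constant on each cell, every cell would have an even number of doors, so the
   parity of the number of doors in a row would be the same for the bottom row,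
   where it is odd, and for the top row, which has none. *)
Lemma bool_poincare_miranda (r u : nat -> nat -> bool) (n : nat) :
  (forall j, (j <= n)%nat -> r O j = false /\ r n j = true) ->
  (forall i, (i <= n)%nat -> u i O = false /\ u i n = true) ->
  exists i j, (i < n)%nat /\ (j < n)%nat /\
    ~ constant_on_cell r i j /\ ~ constant_on_cell u i j.
Proof.
  intros Hr Hu. apply NNPP; intros Hno.
  set (row := fun j => xor_sum (fun i => door r u i j (S i) j) n).
  assert (Hbottom : row O = true).
  { unfold row. rewrite (xor_sum_telescope _ (fun i => r i O)).
    - destruct (Hr O) as [-> ->]; [lia|reflexivity].
    - intros i Hi. unfold door. destruct (Hu i) as [-> _]; [lia|].
      destruct (Hu (S i)) as [-> _]; [lia|reflexivity]. }
  assert (Htop : row n = false).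
  { unfold row. rewrite (xor_sum_telescope _ (fun _ => false)); [reflexivity|].
    intros i Hi. unfold door. destruct (Hu i) as [_ ->]; [lia|reflexivity]. }
  assert (Hstep : forall j, (j < n)%nat -> row (S j) = row j).
  { intros j Hj. apply xorb_eq. rewrite xorb_comm. unfold row.
    rewrite <- xor_sum_xorb, (xor_sum_telescope _ (fun i => door r u i j i (S j))).
    - unfold door. destruct (Hr j) as [-> ->]; [lia|].
      destruct (Hr (S j)) as [-> ->]; [lia|].
      rewrite !xorb_nilpotent, !andb_false_r. reflexivity.
    - intros i Hi. apply cell_doors_even, NNPP. intros Hn.
      apply Hno. exists i, j. tauto. }
  assert (Hodd : forall j, (j <= n)%nat -> row j = true).
  { induction j as [|j IH]; intros Hj; [exact Hbottom|].
    rewrite Hstep by lia. apply IH. lia. }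
  rewrite Hodd in Htop by lia. discriminate.
Qed.

Definition cell_sign_change (h : nat -> nat -> R) (i j : nat) : Prop :=
  exists k l k' l',
    corner i j k l /\ corner i j k' l' /\ h k l <= 0 <= h k' l'.

Lemma cell_sign_change_not_constant (h : nat -> nat -> R) (b : nat -> nat -> bool)
    (i j : nat) :
  (forall i' j', corner i j i' j' -> if b i' j' then 0 <= h i' j' else h i' j' <= 0) ->
  ~ constant_on_cell b i j -> cell_sign_change h i j.
Proof.
  intros Hb Hvar. apply NNPP; intros Hno. apply Hvar.
  assert (Hmixed : forall k l k' l', corner i j k l -> corner i j k' l' ->
    b k l = false -> b k' l' = true -> False).
  { intros k l k' l' Hkl Hkl' Ekl Ekl'. apply Hno. exists k, l, k', l'.
    split; [exact Hkl|]. split; [exact Hkl'|].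
    apply Hb in Hkl, Hkl'. rewrite Ekl in Hkl. rewrite Ekl' in Hkl'.
    split; assumption. }
  intros k l k' l' Hkl Hkl'.
  destruct (b k l) eqn:Ekl, (b k' l') eqn:Ekl'; try reflexivity; exfalso; eauto.
Qed.

Lemma grid_poincare_miranda (f g : nat -> nat -> R) (n : nat) :
  (0 < n)%nat ->
  (forall j, (j <= n)%nat -> f O j <= 0 <= f n j) ->
  (forall i, (i <= n)%nat -> g i O <= 0 <= g i n) ->
  exists i j, (i < n)%nat /\ (j < n)%nat /\
    cell_sign_change f i j /\ cell_sign_change g i j.
Proof.
  intros Hn Hf Hg.
  set (r := fun i j => if Rlt_dec 0 (f i j) then true else (i =? n)%nat).
  set (u := fun i j => if Rlt_dec 0 (g i j) then true else (j =? n)%nat).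
  assert (Hzero : (0 =? n)%nat = false) by (apply Nat.eqb_neq; lia).
  destruct (bool_poincare_miranda r u n) as [i [j [Hi [Hj [Vr Vu]]]]].
  - intros j Hj. specialize (Hf j Hj). unfold r. rewrite Nat.eqb_refl, Hzero.
    destruct (Rlt_dec 0 (f O j)), (Rlt_dec 0 (f n j)); split; lra || reflexivity.
  - intros i Hi. specialize (Hg i Hi). unfold u. rewrite Nat.eqb_refl, Hzero.
    destruct (Rlt_dec 0 (g i O)), (Rlt_dec 0 (g i n)); split; lra || reflexivity.
  - exists i, j. repeat split; try assumption.
    + apply (cell_sign_change_not_constant f r); [|exact Vr].
      intros i' j' [_ Cj]. unfold r. destruct (Rlt_dec 0 (f i' j')); [lra|].
      destruct (Nat.eqb_spec i' n) as [->|_]; [apply Hf; lia|lra].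
    + apply (cell_sign_change_not_constant g u); [|exact Vu].
      intros i' j' [Ci _]. unfold u. destruct (Rlt_dec 0 (g i' j')); [lra|].
      destruct (Nat.eqb_spec j' n) as [->|_]; [apply Hg; lia|lra].
Qed.

Definition sign_change (d : R) (f : R * R -> R) (z : R * R) : Prop :=
  exists w w', ball z d w /\ ball z d w' /\ f w <= 0 <= f w'.

Lemma no_sign_change_near (f : R * R -> R) (z : R * R) :
  continuous f z -> f z <> 0 ->
  filter_prod (at_right 0) (locally z) (fun p => ~ sign_change (fst p) f (snd p)).
Proof.
  intros Hf Hz.
  destruct (proj1 (filterlim_locally f (f z)) Hf (mkposreal _ (Rabs_pos_lt _ Hz)))
    as [e He].
  exists (fun d => d < e / 2) (ball z (e / 2)).
  - exists (pos_div_2 e). intros d Hd _.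
    apply (proj1 (ball_Rabs _ _ _)), Rabs_def2 in Hd. simpl in Hd. lra.
  - exact (locally_ball z (pos_div_2 e)).
  - intros d y Hd Hy [w [w' [Hw [Hw' Hs]]]].
    assert (Hnear : forall v, ball y d v -> Rabs (f v - f z) < Rabs (f z)).
    { intros v Hv. apply He. apply (ball_le z (e / 2 + d)); [lra|].
      apply ball_triangle with y; assumption. }
    apply Hnear, Rabs_lt_between in Hw. apply Hnear, Rabs_lt_between in Hw'.
    destruct (Rdichotomy _ _ Hz) as [Hneg|Hpos];
      [rewrite (Rabs_left (f z)) in Hw' by exact Hneg
      |rewrite (Rabs_right (f z)) in Hw by lra]; lra.
Qed.

Lemma INR_div_unit (i n : nat) : (0 < n)%nat -> (i <= n)%nat -> 0 <= INR i / INR n <= 1.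
Proof.
  intros Hn Hi. assert (HnR : 0 < INR n) by (apply lt_0_INR; lia).
  apply le_INR in Hi. split.
  - apply Rdiv_le_0_compat; [apply pos_INR|exact HnR].
  - apply Rle_div_l; lra.
Qed.

Lemma sign_change_of_cell (f : R * R -> R) (n i j : nat) (d : R) :
  (0 < n)%nat -> / INR n < d ->
  cell_sign_change (fun i' j' => f (INR i' / INR n, INR j' / INR n)) i j ->
  sign_change d f (INR i / INR n, INR j / INR n).
Proof.
  intros Hn Hd [k [l [k' [l' [Hkl [Hkl' Hs]]]]]].
  assert (HnR : 0 < INR n) by (apply lt_0_INR; exact Hn).
  pose proof (Rinv_0_lt_compat _ HnR).
  assert (Hnear : forall p q, q = p \/ q = S p ->
    ball (INR p / INR n) d (INR q / INR n)).
  { intros p q Hpq. apply ball_Rabs. destruct Hpq as [-> | ->].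
    - rewrite Rminus_diag, Rabs_R0. lra.
    - replace (_ - _) with (/ INR n) by (rewrite S_INR; field; lra).
      rewrite Rabs_pos_eq; lra. }
  exists (INR k / INR n, INR l / INR n), (INR k' / INR n, INR l' / INR n).
  split; [split; apply Hnear; apply Hkl|].
  split; [split; apply Hnear; apply Hkl'|exact Hs].
Qed.

(* No sign change of [f] and [g] occurs in a common cell of a fine enough grid if
   [f] and [g] have no common zero. *)
Theorem poincare_miranda (f g : R * R -> R) :
  (forall z, continuous f z) -> (forall z, continuous g z) ->
  (forall y, 0 <= y <= 1 -> f (0, y) <= 0 <= f (1, y)) ->
  (forall x, 0 <= x <= 1 -> g (x, 0) <= 0 <= g (x, 1)) ->
  exists z, 0 <= fst z <= 1 /\ 0 <= snd z <= 1 /\ f z = 0 /\ g z = 0.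
Proof.
  intros Hf Hg Hfside Hgside. apply NNPP; intros Hno.
  assert (Hcells : at_right 0 (fun d => forall z, 0 <= fst z <= 1 -> 0 <= snd z <= 1 ->
    ~ (sign_change d f z /\ sign_change d g z))).
  { apply (filter_forall_rectangle (at_right 0)
      (fun d z => ~ (sign_change d f z /\ sign_change d g z))).
    intros z Hx Hy. destruct (Req_dec (f z) 0) as [Ef|Nf].
    - assert (Ng : g z <> 0) by (intros Eg; apply Hno; exists z; auto).
      generalize (no_sign_change_near g z (Hg z) Ng). apply filter_imp. tauto.
    - generalize (no_sign_change_near f z (Hf z) Nf). apply filter_imp. tauto. }
  assert (Hpos : at_right 0 (fun d => 0 < d)) by (exists (mkposreal 1 Rlt_0_1); auto).
  destruct (filter_ex _ (filter_and _ _ Hcells Hpos)) as [d [Hd Hdpos]].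
  destruct (archimed_cor1 d Hdpos) as [n [Hn Hnpos]].
  set (node := fun i j => (INR i / INR n, INR j / INR n)).
  destruct (grid_poincare_miranda (fun i j => f (node i j)) (fun i j => g (node i j)) n)
    as [i [j [Hi [Hj [Cf Cg]]]]]; [exact Hnpos| | |].
  - intros j Hj. unfold node. rewrite Rdiv_0_l, Rdiv_diag by (apply not_0_INR; lia).
    apply Hfside, INR_div_unit; assumption.
  - intros i Hi. unfold node. rewrite Rdiv_0_l, Rdiv_diag by (apply not_0_INR; lia).
    apply Hgside, INR_div_unit; assumption.
  - apply (Hd (node i j)); [apply INR_div_unit; lia..|].
    split; apply (sign_change_of_cell _ n); assumption.
Qed.

(** * Chords of plane paths *)

Definition interp (u v k : R) : R := u + k * (v - u).

Lemma interp_between (c d u v k : R) :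
  c <= u <= d -> c <= v <= d -> 0 <= k <= 1 -> c <= interp u v k <= d.
Proof. unfold interp; intros; nra. Qed.

Lemma continuous_interp {U : UniformSpace} (u v k : U -> R) (x : U) :
  continuous u x -> continuous v x -> continuous k x ->
  continuous (fun y => interp (u y) (v y) (k y)) x.
Proof.
  intros Hu Hv Hk. apply (continuous_plus u); [exact Hu|].
  apply (continuous_mult k); [exact Hk|]. apply (continuous_minus v u); assumption.
Qed.

Definition wedge (a b c : R) (z : R * R) : R := interp (interp a b (fst z)) c (snd z).

Lemma wedge_between (a b c : R) (z : R * R) :
  0 <= fst z <= 1 -> 0 <= snd z <= 1 -> a <= c <= b -> a <= wedge a b c z <= b.
Proof. intros Hx Hy Hc. repeat apply interp_between; lra. Qed.

Lemma continuous_wedge (a b c : R) (z : R * R) : continuous (wedge a b c) z.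
Proof.
  destruct z as [x y].
  apply continuous_interp; [|apply continuous_const|apply continuous_snd].
  apply continuous_interp; [apply continuous_const..|apply continuous_fst].
Qed.

(* A chord is a zero of (s,t) |-> (Y s - Y t, X t - X s - 1) on the triangle
   a <= s <= t <= b, which is the image of the unit square under the pair
   [(wedge a b a, wedge a b b)]; the side [snd z = 0] is sent to the diagonal and
   the side [snd z = 1] to the corner (a,b). *)
Lemma unit_chord (X Y : R -> R) (a b : R) :
  (forall s, continuous X s) -> (forall s, continuous Y s) -> a <= b ->
  (forall s, a <= s <= b -> Y a <= Y s) -> Y b = Y a -> X a + 1 <= X b ->
  exists s t, a <= s <= b /\ a <= t <= b /\ X t = X s + 1 /\ Y t = Y s.
Proof.
  intros HX HY Hab HYa HYb HXab.
  assert (Cdiff : forall h c c', (forall s, continuous h s) ->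
    forall z, continuous (fun z => h (wedge a b c z) - h (wedge a b c' z)) z).
  { intros h c c' Hh z.
    apply (continuous_minus (fun z => h (wedge a b c z)) (fun z => h (wedge a b c' z)));
      apply (continuous_comp (wedge a b _) h); auto using continuous_wedge. }
  destruct (poincare_miranda (fun z => Y (wedge a b a z) - Y (wedge a b b z))
    (fun z => X (wedge a b b z) - X (wedge a b a z) - 1)) as [z [Hx [Hy [EY EX]]]].
  - apply Cdiff, HY.
  - intros z. apply (continuous_minus (fun z => X (wedge a b b z) - X (wedge a b a z)));
      [apply Cdiff, HX|apply continuous_const].
  - intros y Hy. split.
    + replace (wedge a b a (0, y)) with a by (unfold wedge, interp; simpl; ring).
      pose proof (HYa _ (wedge_between a b b (0, y) ltac:(simpl; lra) Hy ltac:(lra))).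
      lra.
    + replace (wedge a b b (1, y)) with b by (unfold wedge, interp; simpl; ring).
      pose proof (HYa _ (wedge_between a b a (1, y) ltac:(simpl; lra) Hy ltac:(lra))).
      lra.
  - intros x Hx. split.
    + replace (wedge a b b (x, 0)) with (wedge a b a (x, 0))
        by (unfold wedge, interp; simpl; ring). lra.
    + replace (wedge a b a (x, 1)) with a by (unfold wedge, interp; simpl; ring).
      replace (wedge a b b (x, 1)) with b by (unfold wedge, interp; simpl; ring). lra.
  - exists (wedge a b a z), (wedge a b b z).
    repeat split; try apply wedge_between; lra.
Qed.

Definition is_sign (e : R) : Prop := e = 1 \/ e = -1.

Lemma Rabs_sign (x : R) : exists e, is_sign e /\ e * x = Rabs x.
Proof.
  unfold Rabs, is_sign.
  destruct (Rcase_abs x); [exists (-1)|exists 1]; split; auto; ring.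
Qed.

Lemma Rabs_mult_sign (e x : R) : is_sign e -> Rabs (e * x) = Rabs x.
Proof.
  intros [-> | ->]; [f_equal; ring|].
  rewrite <- (Rabs_Ropp x). f_equal; ring.
Qed.

Lemma closed_superset_of_open_interval (E : R -> Prop) (a b s : R) :
  closed E -> a < b -> (forall u, a < u < b -> E u) -> a <= s <= b -> E s.
Proof.
  intros HE Hab Hin Hs. apply HE; intros [d Hd].
  set (k := Rmin 1 (d / (b - a))).
  assert (Hk : 0 < k).
  { apply Rmin_glb_lt; [lra|]. apply Rdiv_lt_0_compat; [apply cond_pos|lra]. }
  assert (Hkle : k <= 1) by apply Rmin_l.
  assert (Hkd : k * (b - a) <= d) by (apply Rle_div_r; [lra|apply Rmin_r]).
  apply (Hd (interp s ((a + b) / 2) k)).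
  - apply ball_Rabs, Rabs_def1; unfold interp; nra.
  - apply Hin. unfold interp. nra.
Qed.

Lemma excursion_one_side (Y : R -> R) (a b M : R) :
  (forall s, continuous Y s) -> a < b -> Rabs (Y a) <= M -> Rabs (Y b) <= M ->
  (forall s, a < s < b -> M < Rabs (Y s)) ->
  exists e, is_sign e /\ e * Y a = M /\ e * Y b = M /\
    forall s, a <= s <= b -> M <= e * Y s.
Proof.
  intros HY Hab Ha Hb Hout. set (m := (a + b) / 2).
  assert (Hm : M < Rabs (Y m)) by (apply Hout; unfold m; lra).
  destruct (Rabs_sign (Y m)) as [e [He Em]].
  assert (HeY : forall s, continuous (fun s => e * Y s) s).
  { intros s. apply (continuous_scal_r e Y), HY. }
  assert (Hinside : forall s, a < s < b -> M <= e * Y s).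
  { intros s Hs. apply Rnot_lt_le; intros Hlt.
    destruct (continuous_IVT (fun u => e * Y u) (Rmin s m) (Rmax s m) M HeY)
      as [u [Hu Eu]].
    - apply Rminmax.
    - unfold Rmin, Rmax. destruct (Rle_dec s m); lra.
    - assert (HMu : M < Rabs (Y u)).
      { apply Hout. revert Hu. unfold m, Rmin, Rmax. destruct (Rle_dec s _); lra. }
      pose proof (Rabs_pos (Y a)).
      rewrite <- (Rabs_mult_sign e), Eu, Rabs_pos_eq in HMu; [lra|lra|exact He]. }
  assert (Hside : forall s, a <= s <= b -> M <= e * Y s).
  { intros s. apply (closed_superset_of_open_interval (fun u => M <= e * Y u));
      [|exact Hab|exact Hinside].
    apply (closed_comp (fun u => e * Y u) (fun v => M <= v));
      [exact HeY|apply closed_ge]. }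
  assert (HeR : forall s, e * Y s <= Rabs (Y s)).
  { intros s. rewrite <- (Rabs_mult_sign e) by exact He. apply Rle_abs. }
  exists e. pose proof (Hside a). pose proof (Hside b).
  pose proof (HeR a). pose proof (HeR b). repeat split; try assumption; lra.
Qed.

(* If the path skips the gap, then between adjacent points of the band with
   [v <= X] and [X <= u] it makes an excursion to one side of the band, and
   [unit_chord] applies to that excursion. *)
Lemma chord_or_gap_point (X Y : R -> R) (a b M u v : R) :
  (forall s, continuous X s) -> (forall s, continuous Y s) -> a <= b ->
  Rabs (Y a) <= M -> v <= X a -> Rabs (Y b) <= M -> X b <= u -> u + 1 <= v ->
  (exists s, a <= s <= b /\ Rabs (Y s) <= M /\ u < X s < v) \/
  (exists s t, a <= s <= b /\ a <= t <= b /\ X t = X s + 1 /\ Y t = Y s).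
Proof.
  intros HX HY Hab HYa HXa HYb HXb Huv.
  assert (Hband : closed (fun s => Rabs (Y s) <= M)).
  { apply (closed_comp (fun s => Rabs (Y s)) (fun y => y <= M)); [|apply closed_le].
    intros s. apply (continuous_comp Y Rabs); [apply HY|apply continuous_Rabs]. }
  destruct (closed_adjacent (fun s => Rabs (Y s) <= M /\ v <= X s)
    (fun s => Rabs (Y s) <= M /\ X s <= u) a b)
    as [s [t [Hst [Htb [[Ys Xs] [[Yt Xt] Hbetween]]]]]]; try tauto.
  { apply closed_and; [exact Hband|].
    apply (closed_comp X (fun x => v <= x)); [exact HX|apply closed_ge]. }
  { apply closed_and; [exact Hband|].
    apply (closed_comp X (fun x => x <= u)); [exact HX|apply closed_le]. }
  assert (Hlt : s < t) by (destruct (Req_dec s t) as [E|]; [rewrite E in *|]; lra).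
  apply NNPP; intros Hno.
  destruct (excursion_one_side Y s t M HY Hlt Ys Yt) as [e [He [Es [Et Hside]]]].
  { intros w Hw. apply Rnot_le_lt; intros Yw. apply Hno. left. exists w.
    destruct (Hbetween w Hw). split; [lra|]. split; [exact Yw|].
    split; apply Rnot_le_lt; tauto. }
  destruct (unit_chord (fun w => - X w) (fun w => e * Y w) s t)
    as [p [q [Hp [Hq [EX EY]]]]]; try lra.
  - intros w. apply (continuous_opp X), HX.
  - intros w. apply (continuous_scal_r e Y), HY.
  - intros w Hw. rewrite Es. apply Hside, Hw.
  - apply Hno. right. exists q, p. repeat split; try lra.
    destruct He as [-> | ->]; lra.
Qed.

(** * Deck-equivariant maps of the plane *)

Lemma ball_dist2 (z w : pt) (d : R) : ball z d w <-> dist2 w z < d.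
Proof.
  unfold dist2. split.
  - intros [Hx Hy]. apply Rmax_lub_lt; assumption.
  - intros Hmax. split; apply ball_Rabs; eapply Rle_lt_trans;
      [apply Rmax_l|exact Hmax|apply Rmax_r|exact Hmax].
Qed.

Lemma cont2_continuous (G : pt -> pt) : cont2 G <-> forall z, continuous G z.
Proof.
  split.
  - intros HG z. apply filterlim_locally. intros eps.
    destruct (HG z eps (cond_pos eps)) as [d [Hd Hw]].
    exists (mkposreal d Hd). intros w Hwz. apply ball_dist2, Hw, ball_dist2, Hwz.
  - intros HG z eps Heps.
    destruct (proj1 (filterlim_locally G (G z)) (HG z) (mkposreal eps Heps)) as [d Hd].
    exists d; split; [apply cond_pos|].
    intros w Hwz. apply ball_dist2, Hd, ball_dist2, Hwz.
Qed.

Definition segment (z w : pt) (k : R) : pt :=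
  (interp (fst z) (fst w) k, interp (snd z) (snd w) k).

Lemma segment_0 (z w : pt) : segment z w 0 = z.
Proof. destruct z; unfold segment, interp; simpl; f_equal; ring. Qed.

Lemma segment_1 (z w : pt) : segment z w 1 = w.
Proof. destruct w; unfold segment, interp; simpl; f_equal; ring. Qed.

Lemma continuous_comp_segment (G : pt -> pt) (z w : pt) (k : R) :
  cont2 G -> continuous (fun k => G (segment z w k)) k.
Proof.
  intros HG. apply (continuous_comp (segment z w) G); [|apply cont2_continuous, HG].
  apply continuous_pair;
    (apply continuous_interp; [apply continuous_const..|apply continuous_id]).
Qed.

(* The sign [e] selects one of the two ends of the annulus. *)
Definition height (e : R) (z : pt) : R := e * snd z.

Lemma height_segment (e : R) (z w : pt) (k : R) :
  height e (segment z w k) = interp (height e z) (height e w) k.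
Proof. unfold height, segment, interp; simpl; ring. Qed.

Lemma segment_height_IVT (G : pt -> pt) (e M : R) (z w : pt) :
  cont2 G ->
  height e (G z) <= M <= height e (G w) \/ height e (G w) <= M <= height e (G z) ->
  exists k, 0 <= k <= 1 /\ height e (G (segment z w k)) = M.
Proof.
  intros HG HM.
  apply (continuous_IVT (fun k => height e (G (segment z w k)))); [|lra|].
  - intros k. apply (continuous_scal_r e (fun k => snd (G (segment z w k)))).
    apply continuous_snd_comp, continuous_comp_segment, HG.
  - rewrite segment_0, segment_1. exact HM.
Qed.

Definition strip (M : R) (z : pt) : Prop := Rabs (snd z) <= M.

Lemma strip_height (e M : R) (z : pt) :
  is_sign e -> strip M z <-> - M <= height e z <= M.
Proof.
  intros He. unfold strip, height.
  rewrite <- (Rabs_mult_sign e) by exact He. apply Rabs_le_between.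
Qed.

Lemma strip_origin (M : R) : 0 <= M -> strip M (0, 0).
Proof. intros HM. unfold strip; simpl. rewrite Rabs_R0. exact HM. Qed.

Lemma strip_mono (M M' : R) (z : pt) : M <= M' -> strip M z -> strip M' z.
Proof. unfold strip. lra. Qed.

Lemma segment_strip (M : R) (z w : pt) (k : R) :
  strip M z -> strip M w -> 0 <= k <= 1 -> strip M (segment z w k).
Proof.
  unfold strip. intros Hz Hw Hk. apply Rabs_le_between in Hz, Hw.
  apply Rabs_le_between, interp_between; assumption.
Qed.

Definition equivariant (G : pt -> pt) : Prop := forall z, G (deckT z) = deckT (G z).

Lemma deck_invariant_forall (Q : pt -> Prop) :
  (forall z, Q z <-> Q (deckT z)) -> (forall z, 0 <= fst z < 1 -> Q z) ->
  forall z, Q z.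
Proof.
  intros HQ H01.
  assert (Htranslate : forall k x y, Q (x, y) <-> Q (x + INR k, y)).
  { induction k as [|k IH]; intros x y; [rewrite Rplus_0_r; reflexivity|].
    rewrite IH, HQ. unfold deckT. cbn [fst snd]. rewrite S_INR, Rplus_assoc.
    reflexivity. }
  intros [x y]. destruct (base_Int_part x) as [Hfloor Hceil].
  destruct (Z_le_gt_dec 0 (Int_part x)) as [Hpos|Hneg].
  - replace x with ((x - IZR (Int_part x)) + INR (Z.to_nat (Int_part x))).
    + apply Htranslate, H01. simpl. lra.
    + rewrite INR_IZR_INZ, Z2Nat.id; [ring|lia].
  - apply (Htranslate (Z.to_nat (- Int_part x))), H01. cbn [fst].
    rewrite INR_IZR_INZ, Z2Nat.id, opp_IZR; [lra|lia].
Qed.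

Lemma filter_forall_strip {T : Type} (F : (T -> Prop) -> Prop) {FF : Filter F}
    (P : T -> pt -> Prop) (M : R) :
  (forall t z, P t z <-> P t (deckT z)) ->
  (forall z, filter_prod F (locally z) (fun p => P (fst p) (snd p))) ->
  F (fun t => forall z, strip M z -> P t z).
Proof.
  intros Hdeck Hloc.
  generalize (filter_forall_rectangle F P 0 1 (- M) M (fun z _ _ => Hloc z)).
  apply filter_imp. intros t Ht.
  apply (deck_invariant_forall (fun z => strip M z -> P t z)).
  - intros z. unfold strip. rewrite (Hdeck t z). reflexivity.
  - intros z Hz Hs. apply Ht; [lra|]. apply Rabs_le_between, Hs.
Qed.

Lemma bounded_on_strip (phi : pt -> R) (M : R) :
  (forall z, continuous phi z) -> (forall z, phi (deckT z) = phi z) ->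
  exists B, 0 <= B /\ forall z, strip M z -> Rabs (phi z) <= B.
Proof.
  intros Hphi Hdeck.
  assert (Hbound : Rbar_locally p_infty (fun B => forall z, strip M z ->
    Rabs (phi z) <= B)).
  { apply (filter_forall_strip (Rbar_locally p_infty) (fun B z => Rabs (phi z) <= B)).
    { intros B z. rewrite Hdeck. reflexivity. }
    intros z.
    exists (fun B => Rabs (phi z) + 1 < B) (fun w => Rabs (phi w - phi z) < 1).
    - exists (Rabs (phi z) + 1); auto.
    - exact (proj1 (filterlim_locally phi (phi z)) (Hphi z) (mkposreal 1 Rlt_0_1)).
    - intros B w HB Hw. pose proof (Rabs_triang_inv (phi w) (phi z)). simpl. lra. }
  assert (Hpos : Rbar_locally p_infty (fun B => 0 <= B)) by (exists 0; intros; lra).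
  destruct (filter_ex _ (filter_and _ _ Hpos Hbound)) as [B [HBpos HB]].
  exists B; split; assumption.
Qed.

Lemma equivariant_bounded_height (G : pt -> pt) (M : R) :
  cont2 G -> equivariant G ->
  exists B, 0 <= B /\ forall z, strip M z -> strip B (G z).
Proof.
  intros HG HT. apply (bounded_on_strip (fun z => snd (G z))).
  - intros z. apply continuous_snd_comp, cont2_continuous, HG.
  - intros z. rewrite HT. reflexivity.
Qed.

Lemma homeo2_injective (G : pt -> pt) : homeo2 G -> forall v w, G v = G w -> v = w.
Proof. intros [_ [g [_ [HgG _]]]] v w E. rewrite <- (HgG v), E. apply HgG. Qed.

Lemma homeo2_iter (F : pt -> pt) (n : nat) : homeo2 F -> homeo2 (Nat.iter n F).
Proof.
  intros [HF [g [Hg [HgF HFg]]]]. induction n as [|n [Hn [h [Hh [HhF HFh]]]]].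
  - split; [|exists (fun z => z); repeat split];
      intros z eps Heps; exists eps; split; auto.
  - assert (Hcomp : forall f f', cont2 f -> cont2 f' -> cont2 (fun z => f (f' z))).
    { intros f f' Hf Hf'. apply cont2_continuous. intros z.
      apply (continuous_comp f' f); apply cont2_continuous; assumption. }
    split; [apply (Hcomp F), Hn; exact HF|].
    exists (fun z => h (g z)). split; [apply Hcomp; assumption|]. split.
    + intros z. rewrite Nat.iter_succ, HgF. apply HhF.
    + intros z. rewrite Nat.iter_succ, HFh. apply HFg.
Qed.

Lemma equivariant_iter (F : pt -> pt) (n : nat) :
  equivariant F -> equivariant (Nat.iter n F).
Proof.
  intros HT. induction n as [|n IH]; intros z; [reflexivity|].
  rewrite !Nat.iter_succ, IH. apply HT.
Qed.

Lemma equivariant_inverse (F g : pt -> pt) :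
  equivariant F -> (forall z, g (F z) = z) -> (forall z, F (g z) = z) -> equivariant g.
Proof. intros HT HgF HFg z. rewrite <- (HFg z) at 1. rewrite <- HT. apply HgF. Qed.

(** * Displacements of returning points *)

Definition disp (G : pt -> pt) (z : pt) : R := fst (G z) - fst z.

Lemma disp_deckT (G : pt -> pt) (z : pt) :
  equivariant G -> disp G (deckT z) = disp G z.
Proof. intros HT. unfold disp. rewrite HT. simpl. ring. Qed.

Lemma equivariant_bounded_disp (G : pt -> pt) (M : R) :
  cont2 G -> equivariant G ->
  exists B, 0 <= B /\ forall z, strip M z -> Rabs (disp G z) <= B.
Proof.
  intros HG HT. apply bounded_on_strip; [|intros z; apply disp_deckT, HT].
  intros z. apply (continuous_minus (fun z => fst (G z)) fst).
  - apply continuous_fst_comp, cont2_continuous, HG.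
  - apply (continuous_fst_comp (fun z => z)), continuous_id.
Qed.

Definition returns (G : pt -> pt) (M : R) (z : pt) : Prop := strip M z /\ strip M (G z).

Lemma returns_mono (G : pt -> pt) (M M' : R) (z : pt) :
  M <= M' -> returns G M z -> returns G M' z.
Proof. intros HM [Hz HGz]. split; apply (strip_mono M); assumption. Qed.

Lemma returns_representative (G : pt -> pt) (M : R) (z : pt) :
  equivariant G -> returns G M z ->
  exists w, 0 <= fst w < 1 /\ returns G M w /\ disp G w = disp G z.
Proof.
  intros HT. revert z. apply (deck_invariant_forall (fun z => returns G M z ->
    exists w, 0 <= fst w < 1 /\ returns G M w /\ disp G w = disp G z)).
  - intros z. unfold returns, strip. rewrite disp_deckT, HT by exact HT. reflexivity.
  - intros z Hz Hret. exists z. auto.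
Qed.

(* The image of a segment joining two returning points of a fundamental domain
   is disjoint from its unit translate. *)
Lemma displacement_gap (G : pt -> pt) (M a b : R) (z z' : pt) :
  cont2 G -> (forall v w, G v = G w -> v = w) -> equivariant G ->
  returns G M z -> b <= disp G z -> returns G M z' -> disp G z' <= a -> a + 2 <= b ->
  exists w, returns G M w /\ a < disp G w < b.
Proof.
  intros HG Hinj HT Hz Hb Hz' Ha Hab.
  destruct (returns_representative G M z HT Hz) as [u [Hu [[Su SGu] Du]]].
  destruct (returns_representative G M z' HT Hz') as [u' [Hu' [[Su' SGu'] Du']]].
  rewrite <- Du in Hb. rewrite <- Du' in Ha. unfold disp in Hb, Ha.
  assert (Hdomain : forall k, 0 <= k <= 1 -> 0 <= fst (segment u u' k) < 1).
  { intros k Hk. pose proof (Rmax_lub_lt _ _ _ (proj2 Hu) (proj2 Hu')).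
    pose proof (Rmax_l (fst u) (fst u')). pose proof (Rmax_r (fst u) (fst u')).
    pose proof (interp_between 0 (Rmax (fst u) (fst u')) (fst u) (fst u') k
      ltac:(lra) ltac:(lra) Hk). simpl. lra. }
  destruct (chord_or_gap_point (fun k => fst (G (segment u u' k)))
    (fun k => snd (G (segment u u' k))) 0 1 M (a + 1) b)
    as [[k [Hk [HY HX]]]|[s [t [Hs [Ht [EX EY]]]]]];
    rewrite ?segment_0, ?segment_1; try assumption; try lra.
  - intros k. apply continuous_fst_comp, continuous_comp_segment, HG.
  - intros k. apply continuous_snd_comp, continuous_comp_segment, HG.
  - exists (segment u u' k). specialize (Hdomain k Hk).
    split; [split; [apply segment_strip|]; assumption|]. unfold disp. lra.
  - exfalso. assert (E : segment u u' t = deckT (segment u u' s)).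
    { apply Hinj. rewrite HT. apply injective_projections; assumption. }
    apply (f_equal fst) in E. unfold deckT in E. cbn [fst] in E.
    pose proof (Hdomain s Hs). pose proof (Hdomain t Ht). lra.
Qed.

Definition positive_returns (G : pt -> pt) (M : R) : Prop :=
  forall z, returns G M z -> 0 < disp G z.

Lemma positive_returns_of_positive_return (G : pt -> pt) (M : R) (z : pt) :
  homeo2 G -> equivariant G -> (forall w, returns G M w -> 1 <= Rabs (disp G w)) ->
  returns G M z -> 0 < disp G z -> positive_returns G M.
Proof.
  intros HG HT Hfar Hz Hdz z' Hz'. apply Rnot_le_lt; intros Hdz'.
  pose proof (Hfar z Hz) as Hlarge. pose proof (Hfar z' Hz') as Hlarge'.
  rewrite Rabs_pos_eq in Hlarge by lra. rewrite Rabs_left1 in Hlarge' by lra.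
  destruct (displacement_gap G M (-1) 1 z z') as [w [Hw Hdw]]; try assumption; try lra.
  - apply HG.
  - apply homeo2_injective, HG.
  - specialize (Hfar w Hw). apply Rabs_lt_between in Hdw. lra.
Qed.

(** * Isotopies preserve the ends of the annulus *)

(* Otherwise the preimage under [G] of a segment in the strip [M] would cross the
   level [B + 1] at a point which [G0] sends into the strip [M + 1]. *)
Lemma preimage_strip_perturb (G0 G : pt -> pt) (M B : R) :
  1 <= M -> 0 <= B -> homeo2 G0 -> homeo2 G ->
  (forall z, strip (M + 1) (G0 z) -> strip B z) ->
  (forall z, strip (B + 1) z -> Rabs (snd (G z) - snd (G0 z)) < 1) ->
  forall z, strip M (G z) -> strip (B + 1) z.
Proof.
  intros HM HB [_ [g0 [_ [_ HG0]]]] [_ [g [Hg [HgG HGg]]]] Hpre Hclose z Hz.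
  apply Rnot_lt_le; intros Hout.
  set (w := g0 (0, 0)).
  assert (Hw : strip B w).
  { apply Hpre. unfold w. rewrite HG0. apply strip_origin. lra. }
  assert (HGw : strip M (G w)).
  { specialize (Hclose w (strip_mono B (B + 1) w ltac:(lra) Hw)). unfold w in *.
    rewrite HG0 in Hclose. simpl in Hclose. rewrite Rminus_0_r in Hclose.
    unfold strip. lra. }
  destruct (Rabs_sign (snd z)) as [e [He Ez]].
  destruct (segment_height_IVT g e (B + 1) (G w) (G z) Hg) as [k [Hk Ek]].
  { left. rewrite !HgG. apply (strip_height e B w He) in Hw. unfold height in *. lra. }
  set (q := g (segment (G w) (G z) k)) in Ek.
  assert (Hq : Rabs (snd q) = B + 1).
  { rewrite <- (Rabs_mult_sign e) by exact He. unfold height in Ek.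
    rewrite Ek. apply Rabs_pos_eq. lra. }
  assert (HGq : strip M (G q)).
  { unfold q. rewrite HGg. apply segment_strip; assumption. }
  assert (HBq : strip B q); [|unfold strip in HBq; lra].
  apply Hpre. specialize (Hclose q (Req_le _ _ Hq)). unfold strip in *.
  rewrite Rabs_minus_sym in Hclose.
  pose proof (Rabs_triang_inv (snd (G0 q)) (snd (G q))). lra.
Qed.

Definition bounded_below (e : R) (G : pt -> pt) : Prop :=
  forall A, exists B, forall z, A <= height e z -> B <= height e (G z).

Definition preserves_ends (G : pt -> pt) : Prop :=
  forall e, is_sign e -> bounded_below e G.

Section Isotopy.

Variable H : R -> pt -> pt.
Hypothesis H_continuous : forall p : R * pt, continuous (fun p => H (fst p) (snd p)) p.
Hypothesis H_homeo : forall t, homeo2 (H t).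
Hypothesis H_equivariant : forall t, equivariant (H t).

Lemma isotopy_close_on_strip (t0 M : R) :
  locally t0 (fun t => forall z, strip M z -> Rabs (snd (H t z) - snd (H t0 z)) < 1).
Proof.
  apply (filter_forall_strip (locally t0)
    (fun t z => Rabs (snd (H t z) - snd (H t0 z)) < 1)).
  - intros t z. rewrite !H_equivariant. reflexivity.
  - intros z. apply locally_filter_prod.
    set (phi := fun p : R * pt => snd (H (fst p) (snd p)) - snd (H t0 (snd p))).
    assert (Hphi : continuous phi (t0, z)).
    { apply (continuous_minus (fun p : R * pt => snd (H (fst p) (snd p)))
        (fun p : R * pt => snd (H t0 (snd p)))).
      - apply (continuous_snd_comp (fun p => H (fst p) (snd p))), H_continuous.
      - apply (continuous_snd_comp (fun p : R * pt => H t0 (snd p))).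
        apply (continuous_comp snd (H t0)); [apply continuous_snd|].
        apply cont2_continuous, H_homeo. }
    destruct (Hphi _ (locally_ball _ (mkposreal 1 Rlt_0_1))) as [d Hd].
    exists d. intros p Hp. specialize (Hd p Hp). apply (proj1 (ball_Rabs _ _ _)) in Hd.
    unfold phi in Hd. simpl in Hd. rewrite Rminus_diag, Rminus_0_r in Hd. exact Hd.
Qed.

Lemma isotopy_proper_near (t0 M : R) :
  1 <= M ->
  filter_prod (Rbar_locally p_infty) (locally t0)
    (fun p => forall z, strip M (H (snd p) z) -> strip (fst p) z).
Proof.
  intros HM. pose proof (H_homeo t0) as [_ [g [Hg [HgH HHg]]]].
  destruct (equivariant_bounded_height g (M + 1) Hg) as [B [HB HgB]].
  { apply (equivariant_inverse (H t0)); auto. }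
  exists (fun B' => B + 1 < B')
    (fun t => forall z, strip (B + 1) z -> Rabs (snd (H t z) - snd (H t0 z)) < 1).
  - exists (B + 1); auto.
  - apply isotopy_close_on_strip.
  - intros B' t HB' Hclose z Hz. simpl in *. apply (strip_mono (B + 1)); [lra|].
    revert z Hz. apply (preimage_strip_perturb (H t0)); auto.
    intros w Hw. rewrite <- (HgH w). apply HgB, Hw.
Qed.

Lemma isotopy_proper (M a b : R) :
  1 <= M -> exists B, forall t, a <= t <= b -> forall z, strip M (H t z) -> strip B z.
Proof.
  intros HM. apply (filter_ex (F := Rbar_locally p_infty)).
  apply (filter_forall_interval (Rbar_locally p_infty)
    (fun B t => forall z, strip M (H t z) -> strip B z)).
  intros t _. apply isotopy_proper_near, HM.
Qed.

(* Beyond some strip the height cannot vanish along the isotopy, so it keeps its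
   sign. *)
Lemma isotopy_bounded_below (e : R) :
  (forall z, H 0 z = z) -> is_sign e -> bounded_below e (H 1).
Proof.
  intros Hid He A.
  destruct (isotopy_proper 1 0 1 (Rle_refl 1)) as [B HB].
  set (B' := Rmax B (Rabs A)).
  pose proof (Rmax_l B (Rabs A) : B <= B').
  pose proof (Rmax_r B (Rabs A) : Rabs A <= B').
  destruct (equivariant_bounded_height (H 1) B' (proj1 (H_homeo 1)) (H_equivariant 1))
    as [C [HCpos HC]].
  exists (- C). intros z Hz.
  destruct (Rle_dec (Rabs (snd z)) B') as [Hin|Hout].
  { apply (strip_height e C); [exact He|]. apply HC, Hin. }
  assert (Hpos : 0 < height e z).
  { pose proof (Rabs_pos A). pose proof (Rle_abs (- A)) as HA. rewrite Rabs_Ropp in HA.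
    rewrite <- (Rabs_mult_sign e) in Hout by exact He. fold (height e z) in Hout.
    revert Hout. unfold Rabs at 1. destruct (Rcase_abs (height e z)); lra. }
  apply Rnot_lt_le; intros Hneg.
  destruct (continuous_IVT (fun t => height e (H t z)) 0 1 0) as [t [Ht Et]]; [|lra| |].
  - intros t. apply (continuous_scal_r e (fun t => snd (H t z))), continuous_snd_comp.
    apply (continuous_comp (fun t => (t, z)) (fun p => H (fst p) (snd p)));
      [|apply H_continuous].
    apply continuous_pair; [apply continuous_id|apply continuous_const].
  - rewrite Hid. lra.
  - apply Hout, (strip_mono B); [assumption|]. apply (HB t Ht).
    apply (strip_height e); [exact He|]. lra.
Qed.

End Isotopy.

Definition clamp (t : R) : R := Rmax 0 (Rmin 1 t).

Lemma clamp_unit (t : R) : 0 <= clamp t <= 1.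
Proof. unfold clamp, Rmax, Rmin. destruct (Rle_dec 1 t), (Rle_dec 0 _); lra. Qed.

Lemma clamp_id (t : R) : 0 <= t <= 1 -> clamp t = t.
Proof. intros Ht. unfold clamp. rewrite Rmin_right, Rmax_right; lra. Qed.

Lemma clamp_lipschitz (s t : R) : Rabs (clamp s - clamp t) <= Rabs (s - t).
Proof.
  unfold clamp, Rmax, Rmin, Rabs.
  destruct (Rle_dec 1 t), (Rle_dec 1 s);
    repeat destruct (Rle_dec 0 _); repeat destruct (Rcase_abs _); lra.
Qed.

Lemma lifted_isotopy_preserves_ends (H : R -> pt -> pt) :
  lifted_isotopy H -> preserves_ends (H 1).
Proof.
  intros [Hcont [Hid [Hhomeo HT]]] e He.
  rewrite <- (clamp_id 1) by lra.
  apply (isotopy_bounded_below (fun t => H (clamp t))); [| | | |exact He].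
  - intros [t z]. apply filterlim_locally. intros eps.
    destruct (Hcont (clamp t) z eps (clamp_unit t) (cond_pos eps)) as [d [Hd Hnear]].
    exists (mkposreal d Hd). intros [s w] [Hs Hw]. apply ball_dist2, Hnear.
    + apply clamp_unit.
    + apply (Rle_lt_trans _ _ _ (clamp_lipschitz s t)), Hs.
    + apply ball_dist2, Hw.
  - intros t. apply Hhomeo, clamp_unit.
  - intros t z. apply HT, clamp_unit.
  - intros z. rewrite clamp_id by lra. apply Hid.
Qed.

Lemma bounded_below_iter (e : R) (F : pt -> pt) (n : nat) :
  bounded_below e F -> bounded_below e (Nat.iter n F).
Proof.
  intros HF. induction n as [|n IH]; intros A; [exists A; auto|].
  destruct (IH A) as [B HB]. destruct (HF B) as [C HC].
  exists C. intros z Hz. apply HC, HB, Hz.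
Qed.

Lemma bounded_below_iter_upto (e : R) (F : pt -> pt) (A : R) (n : nat) :
  bounded_below e F ->
  exists B, forall k z,
    (k < n)%nat -> A <= height e z -> B <= height e (Nat.iter k F z).
Proof.
  intros HF. induction n as [|n [B HB]]; [exists 0; intros; lia|].
  destruct (bounded_below_iter e F n HF A) as [C HC].
  exists (Rmin B C). intros k z Hk Hz. destruct (Nat.eq_dec k n) as [->|Hne].
  - apply (Rle_trans _ C); [apply Rmin_r|apply HC, Hz].
  - apply (Rle_trans _ B); [apply Rmin_l|apply HB; [lia|exact Hz]].
Qed.

(** * Pushing a strip off itself *)

Definition pushes_off (e : R) (G : pt -> pt) (M : R) : Prop :=
  forall z, - M <= height e z -> M < height e (G z).

Lemma strip_image_above (e : R) (G : pt -> pt) (M : R) (w : pt) :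
  is_sign e -> cont2 G -> (forall z, ~ returns G M z) ->
  strip M w -> M < height e (G w) ->
  forall z, strip M z -> M < height e (G z).
Proof.
  intros He HG Hno Hw HGw z Hz. apply Rnot_le_lt; intros Hle.
  destruct (segment_height_IVT G e M w z HG) as [k [Hk Ek]]; [lra|].
  assert (HM : 0 <= M) by (pose proof (Rabs_pos (snd w)); unfold strip in Hw; lra).
  apply (Hno (segment w z k)). split; [apply segment_strip; assumption|].
  apply (strip_height e); [exact He|lra].
Qed.

(* A vertical segment going down from [G z] to a point whose preimage lies below
   the level [M] would meet the image of that level. *)
Lemma strip_above_pushes_off (e : R) (G : pt -> pt) (M : R) :
  is_sign e -> homeo2 G -> bounded_below e G -> 0 <= M ->
  (forall z, strip M z -> M < height e (G z)) -> pushes_off e G M.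
Proof.
  intros He [HG [g [Hg [HgG HGg]]]] Hbelow HM Habove z Hz.
  destruct (Rle_dec (height e z) M) as [Hle|Hgt].
  { apply Habove, (strip_height e); [exact He|lra]. }
  apply Rnot_le_lt; intros HGz.
  destruct (Hbelow M) as [B HB].
  set (y := Rmin (height e (G z)) (B - 1)).
  pose proof (Rmin_l (height e (G z)) (B - 1) : y <= _).
  pose proof (Rmin_r (height e (G z)) (B - 1) : y <= _).
  set (w := (fst (G z), e * y)).
  assert (Hw : height e w = y).
  { unfold height, w; simpl. destruct He as [-> | ->]; ring. }
  destruct (segment_height_IVT g e M (G z) w Hg) as [k [Hk Ek]].
  { right. rewrite HgG. split; [|lra].
    apply Rnot_lt_le; intros Hgw. specialize (HB (g w) (Rlt_le _ _ Hgw)).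
    rewrite HGg in HB. lra. }
  assert (Hbad : M < height e (G (g (segment (G z) w k)))).
  { apply Habove, (strip_height e); [exact He|lra]. }
  rewrite HGg, height_segment, Hw in Hbad. unfold interp in Hbad. nra.
Qed.

Lemma no_return_pushes_off (G : pt -> pt) (M : R) :
  homeo2 G -> preserves_ends G -> 0 <= M ->
  (forall z, ~ returns G M z) -> exists e, is_sign e /\ pushes_off e G M.
Proof.
  intros HG Hbelow HM Hno. pose proof (strip_origin M HM) as Horigin.
  destruct (Rabs_sign (snd (G (0, 0)))) as [e [He Eabs]].
  exists e; split; [exact He|].
  apply strip_above_pushes_off; auto.
  apply (strip_image_above e G M (0, 0)); try assumption; [apply HG|].
  unfold height. rewrite Eabs. apply Rnot_le_lt; intros Hin.
  apply (Hno (0, 0)). split; assumption.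
Qed.

Lemma pushes_off_iter_mul (e : R) (F : pt -> pt) (M : R) (n k : nat) :
  0 <= M -> pushes_off e (Nat.iter n F) M -> (1 <= k)%nat ->
  pushes_off e (Nat.iter (k * n) F) M.
Proof.
  intros HM Hn Hk. induction Hk as [|k Hk IH]; [rewrite Nat.mul_1_l; exact Hn|].
  intros z Hz. change (S k * n)%nat with (n + k * n)%nat. rewrite Nat.iter_add.
  apply Hn. specialize (IH z Hz). lra.
Qed.

(* The times [n] and [n'] have a common multiple. *)
Lemma pushes_off_same_sign (e e' : R) (F : pt -> pt) (M M' : R) (n n' : nat) :
  is_sign e -> is_sign e' -> 0 <= M -> 0 <= M' -> (1 <= n)%nat -> (1 <= n')%nat ->
  pushes_off e (Nat.iter n F) M -> pushes_off e' (Nat.iter n' F) M' -> e' = e.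
Proof.
  intros He He' HM HM' Hn Hn' Hpush Hpush'.
  pose proof (pushes_off_iter_mul e F M n n' HM Hpush Hn' (0, 0)) as Hup.
  pose proof (pushes_off_iter_mul e' F M' n' n HM' Hpush' Hn (0, 0)) as Hup'.
  rewrite Nat.mul_comm in Hup'. unfold height in Hup, Hup'.
  simpl (snd (0, 0)) in Hup, Hup'.
  destruct He as [-> | ->], He' as [-> | ->]; lra.
Qed.

Lemma pushes_off_future_above (e : R) (F : pt -> pt) (M : R) (n : nat) :
  bounded_below e F -> 0 <= M -> (1 <= n)%nat -> pushes_off e (Nat.iter n F) M ->
  exists B, forall k z, M <= height e z -> B <= height e (Nat.iter k F z).
Proof.
  intros HF HM Hn Hpush.
  destruct (bounded_below_iter_upto e F M n HF) as [B HB].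
  exists B. induction k as [k IH] using lt_wf_ind. intros z Hz.
  destruct (Nat.lt_ge_cases k n) as [Hk|Hk]; [apply HB; assumption|].
  replace k with ((k - n) + n)%nat by lia. rewrite Nat.iter_add.
  apply IH; [lia|]. apply Rlt_le, Hpush. lra.
Qed.

(* The future of the strip [M] stays above some level [- M'] from time [n] on, and
   is eventually pushed beyond the strip [M']. *)
Lemma pushed_off_never_returns (F : pt -> pt) (M : R) :
  preserves_ends F -> 0 <= M ->
  (forall M', M <= M' -> exists n e,
     (1 <= n)%nat /\ is_sign e /\ pushes_off e (Nat.iter n F) M') ->
  exists k0, forall k z, (k0 <= k)%nat -> ~ returns (Nat.iter k F) M z.
Proof.
  intros HF HM Hpush.
  destruct (Hpush M (Rle_refl M)) as [n [e [Hn [He Hoff]]]].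
  destruct (pushes_off_future_above e F M n (HF e He) HM Hn Hoff) as [B HB].
  set (M' := Rmax M (- B)).
  pose proof (Rmax_l M (- B) : M <= M'). pose proof (Rmax_r M (- B) : - B <= M').
  destruct (Hpush M') as [n' [e' [Hn' [He' Hoff']]]]; [assumption|].
  assert (Hsame : e' = e).
  { apply (pushes_off_same_sign e e' F M M' n n'); try assumption; lra. }
  subst e'. exists (n' + n)%nat. intros k z Hk [Hz Hret].
  apply (strip_height e) in Hz, Hret; try exact He.
  replace k with (n' + ((k - n' - n) + n))%nat in Hret by lia.
  rewrite !Nat.iter_add in Hret.
  assert (Hfuture : - M' <= height e (Nat.iter (k - n' - n) F (Nat.iter n F z))).
  { apply (Rle_trans _ B); [lra|]. apply HB, Rlt_le, Hoff. lra. }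
  apply Hoff' in Hfuture. lra.
Qed.

(** * Returns and rotation numbers *)

Lemma compact_strip (M : R) : compact_annulus (strip M).
Proof.
  split; [intros z; reflexivity|]. split.
  - intros z Hz. unfold strip in *. exists (Rabs (snd z) - M). split; [lra|].
    intros w Hw Hws.
    assert (Hdiff : Rabs (snd w - snd z) < Rabs (snd z) - M) by apply ball_dist2, Hw.
    rewrite Rabs_minus_sym in Hdiff.
    pose proof (Rabs_triang_inv (snd z) (snd w)). lra.
  - exists M. intros z Hz. exact Hz.
Qed.

Lemma rho_n_mul_INR (F : pt -> pt) (n : nat) (z : pt) :
  (1 <= n)%nat -> rho_n F n z * INR n = disp (Nat.iter n F) z.
Proof. intros Hn. unfold rho_n, disp, p1. field. apply not_0_INR. lia. Qed.

Lemma returns_disp_large (F : pt -> pt) (M D : R) :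
  ~ in_rho_K F (strip M) 0 ->
  exists N, forall n z, (N <= n)%nat -> returns (Nat.iter n F) M z ->
    D <= Rabs (disp (Nat.iter n F) z).
Proof.
  intros Hrho. apply NNPP; intros Hno. apply Hrho. intros m eps Heps.
  destruct (INR_unbounded (D / eps)) as [k Hk].
  apply NNPP; intros Hfar. apply Hno. exists (S (m + k)). intros n z Hn [Hz HFz].
  apply Rnot_lt_le; intros Hlt. apply Hfar. exists n, z.
  repeat split; try assumption; [lia|lia|].
  assert (HnR : 0 < INR n) by (apply lt_0_INR; lia).
  rewrite Rminus_0_r. apply (Rmult_lt_reg_r (INR n)); [exact HnR|].
  rewrite <- (Rabs_pos_eq (INR n)) at 1 by lra.
  rewrite <- Rabs_mult, rho_n_mul_INR by lia.
  apply Rlt_div_l in Hk; [|exact Heps].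
  assert (INR k <= INR n) by (apply le_INR; lia). nra.
Qed.

(* One more iterate changes the displacement of a point of the strip by less than
   its size, and [M'] is so large that the point still counts as returning. *)
Lemma positive_returns_succ (F : pt -> pt) (M M' D : R) (n : nat) (z : pt) :
  homeo2 F -> equivariant F -> M <= M' -> 0 <= D ->
  (forall w, strip M w -> strip M' (F w) /\ Rabs (disp F w) <= D) ->
  (forall k w, (n <= k)%nat -> returns (Nat.iter k F) M' w ->
     D + 1 <= Rabs (disp (Nat.iter k F) w)) ->
  returns (Nat.iter n F) M z ->
  positive_returns (Nat.iter n F) M' -> positive_returns (Nat.iter (S n) F) M'.
Proof.
  intros HF HT HM HD HFM Hfar Hz Hpos.
  destruct (HFM _ (proj2 Hz)) as [HFz HdF]. apply Rabs_le_between in HdF.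
  pose proof (returns_mono _ M M' z HM Hz) as Hz'.
  pose proof (Hpos z Hz'). pose proof (Hfar n z (le_n n) Hz') as Hdz.
  rewrite Rabs_pos_eq in Hdz by lra.
  apply (positive_returns_of_positive_return _ M' z);
    auto using homeo2_iter, equivariant_iter.
  - intros w Hw. specialize (Hfar (S n) w ltac:(lia) Hw). lra.
  - split; [apply Hz'|exact HFz].
  - unfold disp in *. simpl. lra.
Qed.

Definition returns_frequently (F : pt -> pt) (M r : R) : Prop :=
  forall m, exists n z,
    (m <= n)%nat /\ returns (Nat.iter n F) M z /\ 0 < r * disp (Nat.iter n F) z.

Lemma exists_time_without_return (F : pt -> pt) (M r r' : R) :
  homeo2 F -> equivariant F -> (forall M', ~ in_rho_K F (strip M') 0) ->
  0 < r -> returns_frequently F M r -> r' < 0 -> returns_frequently F M r' ->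
  exists n, (1 <= n)%nat /\ forall z, ~ returns (Nat.iter n F) M z.
Proof.
  intros HF HT Hrho Hr Hplus Hr' Hminus. apply NNPP; intros Hno.
  assert (Hret : forall n, (1 <= n)%nat -> exists z, returns (Nat.iter n F) M z).
  { intros n Hn. apply NNPP; intros Hn'. apply Hno. exists n. split; [exact Hn|].
    intros z Hz. apply Hn'. exists z. exact Hz. }
  destruct (equivariant_bounded_height F M (proj1 HF) HT) as [B [_ HB]].
  destruct (equivariant_bounded_disp F M (proj1 HF) HT) as [D [HDpos HD]].
  set (M' := Rmax M B).
  assert (HM : M <= M') by apply Rmax_l. assert (HBM : B <= M') by apply Rmax_r.
  destruct (returns_disp_large F M' (D + 1) (Hrho M')) as [N HN].
  destruct (Hplus (S N)) as [n [z [Hn [Hz Hdz]]]].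
  assert (Hpos : forall k, (n <= k)%nat -> positive_returns (Nat.iter k F) M').
  { induction 1 as [|k Hk IH].
    - apply (positive_returns_of_positive_return _ M' z);
        auto using homeo2_iter, equivariant_iter.
      + intros w Hw. specialize (HN n w ltac:(lia) Hw). lra.
      + apply (returns_mono _ M); assumption.
      + nra.
    - destruct (Hret k) as [w Hw]; [lia|].
      apply (positive_returns_succ F M M' D k w); try assumption.
      + intros v Hv. split; [apply (strip_mono B); auto|apply HD, Hv].
      + intros j v Hj. apply HN. lia. }
  destruct (Hminus n) as [k [w [Hk [Hw Hdw]]]].
  specialize (Hpos k Hk w (returns_mono _ M M' w HM Hw)). nra.
Qed.

Lemma exists_pushing_time (F : pt -> pt) (M r r' : R) :
  homeo2 F -> equivariant F -> preserves_ends F -> 0 <= M ->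
  (forall M', ~ in_rho_K F (strip M') 0) ->
  0 < r -> returns_frequently F M r -> r' < 0 -> returns_frequently F M r' ->
  exists n e, (1 <= n)%nat /\ is_sign e /\ pushes_off e (Nat.iter n F) M.
Proof.
  intros HF HT Hends HM Hrho Hr Hplus Hr' Hminus.
  destruct (exists_time_without_return F M r r') as [n [Hn Hno]]; try assumption.
  destruct (no_return_pushes_off (Nat.iter n F) M) as [e [He Hoff]];
    auto using homeo2_iter.
  - intros e He. apply bounded_below_iter, Hends, He.
  - exists n, e. auto.
Qed.

Lemma in_rho_ann_returns_frequently (F : pt -> pt) (r : R) :
  r <> 0 -> in_rho_ann F r ->
  exists M, forall M', M <= M' -> returns_frequently F M' r.
Proof.
  intros Hr Hann. pose proof (Rabs_pos_lt r Hr).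
  destruct (Hann (Rabs r / 2)) as [K [s [[_ [_ [M HM]]] [Hs Hsr]]]]; [lra|].
  exists M. intros M' HMM' m.
  destruct (Hs m (Rabs r / 2)) as [n [z [Hn [Hmn [Hz [HFz Hrho]]]]]]; [lra|].
  exists n, z. split; [exact Hmn|]. split.
  { apply HM in Hz, HFz. split; apply (strip_mono M); assumption. }
  rewrite <- rho_n_mul_INR, <- Rmult_assoc by exact Hn.
  apply Rmult_lt_0_compat; [|apply lt_0_INR; exact Hn].
  apply Rabs_def2 in Hsr, Hrho. revert Hsr Hrho.
  unfold Rabs; destruct (Rcase_abs r); nra.
Qed.

Theorem mainTheorem6 (H : R -> pt -> pt) :
  lifted_isotopy H ->
  (exists r, 0 < r /\ in_rho_ann (H 1) r) ->
  (exists r, r < 0 /\ in_rho_ann (H 1) r) ->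
  exists Kt : pt -> Prop, compact_annulus Kt /\ in_rho_K (H 1) Kt 0.
Proof.
  intros HH [r [Hr Hplus]] [r' [Hr' Hminus]]. apply NNPP; intros Hno.
  assert (HF : homeo2 (H 1)) by (apply HH; lra).
  assert (HT : equivariant (H 1)) by (intros z; apply HH; lra).
  assert (Hends : preserves_ends (H 1)) by (apply lifted_isotopy_preserves_ends, HH).
  assert (Hrho : forall M, ~ in_rho_K (H 1) (strip M) 0)
    by (intros M HM; apply Hno; exists (strip M); auto using compact_strip).
  apply in_rho_ann_returns_frequently in Hplus as [Mp Hp]; [|lra].
  apply in_rho_ann_returns_frequently in Hminus as [Mm Hm]; [|lra].
  set (M0 := Rmax 0 (Rmax Mp Mm)).
  assert (HM0 : 0 <= M0) by apply Rmax_l.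
  pose proof (Rmax_r 0 (Rmax Mp Mm) : _ <= M0).
  pose proof (Rmax_l Mp Mm). pose proof (Rmax_r Mp Mm).
  destruct (pushed_off_never_returns (H 1) M0 Hends HM0) as [k0 Hk0].
  - intros M HM. apply (exists_pushing_time (H 1) M r r');
      try apply Hp; try apply Hm; try assumption; lra.
  - destruct (Hp M0 ltac:(lra) k0) as [n [z [Hn [Hz _]]]]. exact (Hk0 n z Hn Hz).
Qed.
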